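(* Let $q_1,q_2,Y_1,Y_2,\rho>0$ and initial prices $p_{1,0},p_{2,0}>0$ satisfy $p_{2,0}q_2<p_{1,0}q_1<p_{2,0}'q_2$, and suppose $0<Y_1<p_{1,0}q_1$, $0<Y_2<p_{2,0}q_2$. This region is divided into: Zone 1-1: $\frac{Y_1}{p_{1,0}}+\frac{Y_2}{p_{1,0}'}<q_1$ and $\frac{Y_1}{p_{2,0}'}+\frac{Y_2}{p_{2,0}}<q_2$ (strictly below $\ell_{1,0}$ and strictly below $\ell_{2,0}$); Zone 1-2: $\frac{Y_1}{p_{1,0}}+\frac{Y_2}{p_{1,0}'}\ge q_1$ and $\frac{Y_1}{p_{2,0}'}+\frac{Y_2}{p_{2,0}}<q_2$; Zone 1-3: $\frac{Y_1}{p_{1,0}}+\frac{Y_2}{p_{1,0}'}<q_1$ and $\frac{Y_1}{p_{2,0}'}+\frac{Y_2}{p_{2,0}}\ge q_2$; Zone 1-4: $\frac{Y_1}{p_{1,0}}+\frac{Y_2}{p_{1,0}'}\ge q_1$ and $\frac{Y_1}{p_{2,0}'}+\frac{Y_2}{p_{2,0}}\ge q_2$. Write $\Delta p=p_{1,0}-p_{2,0}$ and consider the following five patterns (initial NE together with price evolution): (P1) NE $\Big(\frac{Y_1}{p_{1,0}},0,0,\frac{Y_2}{p_{2,0}}\Big)$; after one downward price adjustment a type $E$ equilibrium is reached. (P2) NE $\Big(\frac{Y_1}{p_{1,0}},0,q_1-\frac{Y_1}{p_{1,0}},\frac{Y_2-p_{1,0}'(q_1-Y_1/p_{1,0})}{p_{2,0}}\Big)$;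 when $(Y_1,Y_2)$ is strictly above $\ell_{1,0}$, after one downward adjustment in $p_{2,0}$ an $\ell_4$-equilibrium is reached; when $(Y_1,Y_2)\in\ell_{1,0}$, a degenerate $\ell_1$-equilibrium is reached ($p_{2,t}=0$ for all $t\ge1$). (P3) NE $\Big(\frac{Y_1-p_{2,0}'(q_2-Y_2/p_{2,0})}{p_{1,0}},q_2-\frac{Y_2}{p_{2,0}},0,\frac{Y_2}{p_{2,0}}\Big)$; after one downward adjustment in $p_{1,0}$ an $\ell_3$-equilibrium is reached. (P4) NE $\Big(\frac{Y_1}{p_{1,0}},0,\frac{Y_2}{p_{1,0}'},0\Big)$; there is an infinite downward adjustment process in $p_{1,t}$, under which $p_{1,t}$ tends monotonically to $p_{1,\infty}=\frac1{2q_1}\Big(Y_1+Y_2-\rho q_1+\sqrt{(Y_1+Y_2-\rho q_1)^2+4\rho q_1Y_1}\Big)$, while $p_{2,t}=0$ for all $t\ge1$ (the system tends to a degenerate $\ell_1$-equilibrium). (P5) NE $\Big(0,\frac{Y_1}{p_{2,0}'},0,\frac{Y_2}{p_{2,0}}\Big)$; through an infinite downward adjustment process for the second price the system tends to a degenerate $\ell_2$-equilibrium. Then: a) in zone 1-4: (P1) holds if $\Delta p\in[-\rho,\rho]$, (P2) if $\Delta p<-\rho$, (P3) if $\Delta p>\rho$; b) in zone 1-3: (P1) holds if $\Delta p\in[-\rho,\rho]$, (P3) if $\Delta p>\rho$, (P4) if $\Delta p<-\rho$; c) in zone 1-2: (P1) holds if $\Delta p\in[-\rho,\rho]$, (P2)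 if $\Delta p<-\rho$, (P5) if $\Delta p>\rho$; d) in zone 1-1: (P1) holds if $\Delta p\in[-\rho,\rho]$, (P4) if $\Delta p<-\rho$, (P5) if $\Delta p>\rho$.
   Context: Model. Fix $q_1,q_2>0$ (quantities supplied each period in regions I and II), $Y_1,Y_2>0$ (per-period incomes of consumers I and II) and $\rho>0$ (transportation cost). For prices $p_1,p_2\ge 0$ write $p_i'=p_i+\rho$ (and $p_{i,t}'=p_{i,t}+\rho$). In each period the following game is played. Consumer I chooses $(\alpha,\beta)\in S_1=\{\alpha,\beta\ge0,\ \alpha p_1+\beta p_2'\le Y_1\}$ (orders in regions I and II); consumer II chooses $(\gamma,\delta)\in S_2=\{\gamma,\delta\ge0,\ \gamma p_1'+\delta p_2\le Y_2\}$ (orders in regions I and II). Payoffs: $P_1=\min(\alpha,q_1)+\min(\beta,\max(0,q_2-\delta))$ and $P_2=\min(\delta,q_2)+\min(\gamma,\max(0,q_1-\alpha))$. Selected best replies. Given $(\gamma,\delta)$, consumer I's best reply is the maximizer of $P_1$ over $S_1$ that (SR1) among all maximizers minimizes the expenditure $p_1\alpha+p_2'\beta$, and (SR2) among those has the largest home order $\alpha$; (SR3) if $p_1=0$ the home order is instead set to $\alpha=q_1$. Given $(\alpha,\beta)$, consumer II's best reply is the maximizer of $P_2$ over $S_2$ that (SR1) minimizes $p_1'\gamma+p_2\delta$, and (SR2) among those has the largest home order $\delta$; (SR3) if $p_2=0$ the home order is set to $\delta=q_2$. A Nash equilibrium (NE) at prices $(p_1,p_2)$ is a quadruple $(\alpha,\beta,\gamma,\delta)$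 in which each consumer's orders are the selected best reply to the other's. Price dynamics (discrete time). At time $t$, with prices $p_{1,t},p_{2,t}$ and corresponding NE $(\alpha,\beta,\gamma,\delta)$, put $q_1^{cons}=\alpha+\gamma$, $q_2^{cons}=\beta+\delta$, $Y_1^{res}=Y_1-p_{2,t}'\beta$, $Y_2^{res}=Y_2-p_{1,t}'\gamma$. If $q_i^{cons}<q_i$, then $p_{i,t+1}=p_{i,t}q_i^{cons}/q_i$ (downward adjustment); if $Y_i^{res}>p_{i,t}q_i$, then $p_{i,t+1}=Y_i^{res}/q_i$ (upward adjustment); otherwise $p_{i,t+1}=p_{i,t}$. Lines in the $(\tilde Y_1,\tilde Y_2)$-plane at prices $(p_1,p_2)$: $\ell_1:\ q_1=\frac{\tilde Y_1}{p_1}+\frac{\tilde Y_2}{p_1'}$; $\ell_2:\ q_2=\frac{\tilde Y_1}{p_2'}+\frac{\tilde Y_2}{p_2}$; $\ell_3:\ p_1q_1+p_2'q_2=\tilde Y_1+\frac{p_2'}{p_2}\tilde Y_2$; $\ell_4:\ p_1'q_1+p_2q_2=\frac{p_1'}{p_1}\tilde Y_1+\tilde Y_2$. The lines at time-$t$ prices are denoted $\ell_{i,t}$. A point is above (below) a line if the side containing $\tilde Y_1,\tilde Y_2$ is larger (smaller) than the other side. A point of equilibrium (p.e.) for prices is a pair $(p_1,p_2)$ whose NE satisfies $\alpha+\gamma=q_1$, $\beta+\delta=q_2$, $p_1\alpha+p_2'\beta=Y_1$, $p_1'\gamma+p_2\delta=Y_2$; then prices remain unchanged. A type $E$ equilibrium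 is a p.e. with $p_i=Y_i/q_i$, $i=1,2$. An $\ell_4$-equilibrium is a p.e. with $Y_1<p_1q_1$, $p_2q_2\le Y_2$ and $(Y_1,Y_2)\in\ell_4$. An $\ell_3$-equilibrium is a p.e. (with $p_1\ge0$, $p_2>0$) such that $p_1q_1\le Y_1$, $Y_2<p_2q_2$ and $(Y_1,Y_2)\in\ell_3$. A degenerate $\ell_1$-equilibrium is a p.e. with $p_1>0$, $p_2=0$ and $(Y_1,Y_2)\in\ell_1$; a degenerate $\ell_2$-equilibrium is a p.e. with $p_1=0$, $p_2>0$ and $(Y_1,Y_2)\in\ell_2$. The system ''tends to'' a degenerate $\ell_1$- (resp. $\ell_2$-) equilibrium through an infinite downward adjustment process in $p_1$ (resp. $p_2$) if $p_{2,t}=0$ (resp. $p_{1,t}=0$) for all $t\ge1$ and the other price decreases at every step, converging to a value such that the limit prices form a degenerate $\ell_1$- (resp. $\ell_2$-) equilibrium. *)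

(* Defs.v *)
(* Stdlib reals; limits of sequences are Stdlib's Un_cv. *)
From Stdlib Require Import Reals.
Open Scope R_scope.

(* Supplies q1, q2 per period, incomes Y1, Y2 per period, transportation
   cost rho.  Positivity is assumed where it is needed. *)
Record economy := Economy { q1 : R; q2 : R; Y1 : R; Y2 : R; rho : R }.

(* Consumer I orders alpha in region I and beta in region II; consumer II
   orders gamma in region I and delta in region II. *)
Record orders := Orders { alpha : R; beta : R; gamma : R; delta : R }.

(** * The one-period game *)

(* The two consumers have the same decision problem with the regions
   exchanged, so it is written once, for a consumer ordering h at home and f
   abroad: ph is the home price, pf the foreign price including transportation,
   qh and qf the supplies, Y the income, and d the order that the other
   consumer places in his own region, where he is served first. *)

Definition feasible (ph pf Y h f : R) : Prop :=
  0 <= h /\ 0 <= f /\ ph * h + pf * f <= Y.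

Definition payoff (qh qf d h f : R) : R :=
  Rmin h qh + Rmin f (Rmax 0 (qf - d)).

Definition maximizer (ph pf qh qf Y d h f : R) : Prop :=
  feasible ph pf Y h f /\
  forall h' f', feasible ph pf Y h' f' ->
    payoff qh qf d h' f' <= payoff qh qf d h f.

(* Rule SR1. *)
Definition cheapest_maximizer (ph pf qh qf Y d h f : R) : Prop :=
  maximizer ph pf qh qf Y d h f /\
  forall h' f', maximizer ph pf qh qf Y d h' f' ->
    ph * h + pf * f <= ph * h' + pf * f'.

(* Rules SR2 and SR3.  At home price 0 the home orders of the cheapest
   maximizers are unbounded above, so SR2 selects nothing and SR3 sets the
   home order to qh instead. *)
Definition best_reply (ph pf qh qf Y d h f : R) : Prop :=
  (ph <> 0 /\ cheapest_maximizer ph pf qh qf Y d h f /\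
   forall h' f', cheapest_maximizer ph pf qh qf Y d h' f' -> h' <= h)
  \/
  (ph = 0 /\ h = qh /\ exists h0, cheapest_maximizer ph pf qh qf Y d h0 f).

Definition is_NE (E : economy) (p1 p2 : R) (o : orders) : Prop :=
  best_reply p1 (p2 + rho E) (q1 E) (q2 E) (Y1 E) (delta o) (alpha o) (beta o) /\
  best_reply p2 (p1 + rho E) (q2 E) (q1 E) (Y2 E) (alpha o) (delta o) (gamma o).

(** * Price dynamics *)

Definition q1_cons (o : orders) : R := alpha o + gamma o.
Definition q2_cons (o : orders) : R := beta o + delta o.

Definition Y1_res (E : economy) (p2 : R) (o : orders) : R :=
  Y1 E - (p2 + rho E) * beta o.
Definition Y2_res (E : economy) (p1 : R) (o : orders) : R :=
  Y2 E - (p1 + rho E) * gamma o.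

Definition downward_adjustment (q qcons p pnext : R) : Prop :=
  qcons < q /\ pnext = p * qcons / q.

Definition price_step (q qcons Yres p pnext : R) : Prop :=
  (qcons < q -> pnext = p * qcons / q) /\
  (Yres > p * q -> pnext = Yres / q) /\
  (~ qcons < q -> ~ Yres > p * q -> pnext = p).

Definition evolution (E : economy) (p10 p20 : R)
    (p1 p2 : nat -> R) (o : nat -> orders) : Prop :=
  p1 0%nat = p10 /\ p2 0%nat = p20 /\
  forall t : nat,
    is_NE E (p1 t) (p2 t) (o t) /\
    price_step (q1 E) (q1_cons (o t)) (Y1_res E (p2 t) (o t)) (p1 t) (p1 (S t)) /\
    price_step (q2 E) (q2_cons (o t)) (Y2_res E (p1 t) (o t)) (p2 t) (p2 (S t)).

(* Downward adjustments of the first (second) price from time t to t + 1. *)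
Definition downward1 (E : economy) (p1 : nat -> R) (o : nat -> orders) (t : nat) : Prop :=
  downward_adjustment (q1 E) (q1_cons (o t)) (p1 t) (p1 (S t)).
Definition downward2 (E : economy) (p2 : nat -> R) (o : nat -> orders) (t : nat) : Prop :=
  downward_adjustment (q2 E) (q2_cons (o t)) (p2 t) (p2 (S t)).

(** * Lines in the income plane *)

(* Each line is only used where the prices in its denominators are positive. *)
Definition on_l1 (E : economy) (p1 p2 y1 y2 : R) : Prop :=
  q1 E = y1 / p1 + y2 / (p1 + rho E).
Definition on_l2 (E : economy) (p1 p2 y1 y2 : R) : Prop :=
  q2 E = y1 / (p2 + rho E) + y2 / p2.
Definition on_l3 (E : economy) (p1 p2 y1 y2 : R) : Prop :=
  p1 * q1 E + (p2 + rho E) * q2 E = y1 + (p2 + rho E) / p2 * y2.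
Definition on_l4 (E : economy) (p1 p2 y1 y2 : R) : Prop :=
  (p1 + rho E) * q1 E + p2 * q2 E = (p1 + rho E) / p1 * y1 + y2.

Definition above_l1 (E : economy) (p1 p2 y1 y2 : R) : Prop :=
  q1 E < y1 / p1 + y2 / (p1 + rho E).
Definition below_l1 (E : economy) (p1 p2 y1 y2 : R) : Prop :=
  y1 / p1 + y2 / (p1 + rho E) < q1 E.
Definition below_l2 (E : economy) (p1 p2 y1 y2 : R) : Prop :=
  y1 / (p2 + rho E) + y2 / p2 < q2 E.

(** * Points of equilibrium *)

Definition is_pe (E : economy) (p1 p2 : R) : Prop :=
  0 <= p1 /\ 0 <= p2 /\
  exists o : orders,
    is_NE E p1 p2 o /\
    alpha o + gamma o = q1 E /\
    beta o + delta o = q2 E /\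
    p1 * alpha o + (p2 + rho E) * beta o = Y1 E /\
    (p1 + rho E) * gamma o + p2 * delta o = Y2 E.

Definition typeE_equilibrium (E : economy) (p1 p2 : R) : Prop :=
  is_pe E p1 p2 /\ p1 = Y1 E / q1 E /\ p2 = Y2 E / q2 E.

Definition l4_equilibrium (E : economy) (p1 p2 : R) : Prop :=
  is_pe E p1 p2 /\ Y1 E < p1 * q1 E /\ p2 * q2 E <= Y2 E /\
  on_l4 E p1 p2 (Y1 E) (Y2 E).

Definition l3_equilibrium (E : economy) (p1 p2 : R) : Prop :=
  is_pe E p1 p2 /\ 0 <= p1 /\ 0 < p2 /\
  p1 * q1 E <= Y1 E /\ Y2 E < p2 * q2 E /\
  on_l3 E p1 p2 (Y1 E) (Y2 E).

Definition degenerate_l1_equilibrium (E : economy) (p1 p2 : R) : Prop :=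
  is_pe E p1 p2 /\ 0 < p1 /\ p2 = 0 /\ on_l1 E p1 p2 (Y1 E) (Y2 E).

Definition degenerate_l2_equilibrium (E : economy) (p1 p2 : R) : Prop :=
  is_pe E p1 p2 /\ p1 = 0 /\ 0 < p2 /\ on_l2 E p1 p2 (Y1 E) (Y2 E).

(* The prices are an equilibrium of the given kind from time 1 on, and no
   longer move. *)
Definition reached_after_one_step (Eq : R -> R -> Prop) (p1 p2 : nat -> R) : Prop :=
  Eq (p1 1%nat) (p2 1%nat) /\
  forall t : nat, (1 <= t)%nat -> p1 t = p1 1%nat /\ p2 t = p2 1%nat.

(* l is the limit of the price that is adjusted downward forever. *)
Definition tends_to_degenerate_l1 (E : economy)
    (p1 p2 : nat -> R) (o : nat -> orders) (l : R) : Prop :=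
  (forall t : nat, (1 <= t)%nat -> p2 t = 0) /\
  (forall t : nat, downward1 E p1 o t /\ p1 (S t) < p1 t) /\
  Un_cv p1 l /\
  degenerate_l1_equilibrium E l 0.

Definition tends_to_degenerate_l2 (E : economy)
    (p1 p2 : nat -> R) (o : nat -> orders) (l : R) : Prop :=
  (forall t : nat, (1 <= t)%nat -> p1 t = 0) /\
  (forall t : nat, downward2 E p2 o t /\ p2 (S t) < p2 t) /\
  Un_cv p2 l /\
  degenerate_l2_equilibrium E 0 l.

(** * The five patterns *)

Definition pattern : Type :=
  economy -> (nat -> R) -> (nat -> R) -> (nat -> orders) -> Prop.

Definition P1 : pattern := fun E p1 p2 o =>
  o 0%nat = Orders (Y1 E / p1 0%nat) 0 0 (Y2 E / p2 0%nat) /\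
  downward1 E p1 o 0 /\ downward2 E p2 o 0 /\
  reached_after_one_step (typeE_equilibrium E) p1 p2.

Definition P2 : pattern := fun E p1 p2 o =>
  o 0%nat = Orders
    (Y1 E / p1 0%nat)
    0
    (q1 E - Y1 E / p1 0%nat)
    ((Y2 E - (p1 0%nat + rho E) * (q1 E - Y1 E / p1 0%nat)) / p2 0%nat) /\
  (above_l1 E (p1 0%nat) (p2 0%nat) (Y1 E) (Y2 E) ->
     downward2 E p2 o 0 /\ p1 1%nat = p1 0%nat /\
     reached_after_one_step (l4_equilibrium E) p1 p2) /\
  (on_l1 E (p1 0%nat) (p2 0%nat) (Y1 E) (Y2 E) ->
     reached_after_one_step (degenerate_l1_equilibrium E) p1 p2 /\
     forall t : nat, (1 <= t)%nat -> p2 t = 0).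

Definition P3 : pattern := fun E p1 p2 o =>
  o 0%nat = Orders
    ((Y1 E - (p2 0%nat + rho E) * (q2 E - Y2 E / p2 0%nat)) / p1 0%nat)
    (q2 E - Y2 E / p2 0%nat)
    0
    (Y2 E / p2 0%nat) /\
  downward1 E p1 o 0 /\ p2 1%nat = p2 0%nat /\
  reached_after_one_step (l3_equilibrium E) p1 p2.

Definition p1_infinity (E : economy) : R :=
  1 / (2 * q1 E) *
  (Y1 E + Y2 E - rho E * q1 E +
   sqrt ((Y1 E + Y2 E - rho E * q1 E) ^ 2 + 4 * rho E * q1 E * Y1 E)).

Definition P4 : pattern := fun E p1 p2 o =>
  o 0%nat = Orders (Y1 E / p1 0%nat) 0 (Y2 E / (p1 0%nat + rho E)) 0 /\
  tends_to_degenerate_l1 E p1 p2 o (p1_infinity E).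

Definition P5 : pattern := fun E p1 p2 o =>
  o 0%nat = Orders 0 (Y1 E / (p2 0%nat + rho E)) 0 (Y2 E / p2 0%nat) /\
  exists l : R, tends_to_degenerate_l2 E p1 p2 o l.

(* The evolution is not presupposed to exist or to be unique: one exists, and
   every one of them follows the pattern, including its initial NE. *)
Definition holds_from (E : economy) (p10 p20 : R) (P : pattern) : Prop :=
  (exists p1 p2 o, evolution E p10 p20 p1 p2 o) /\
  (forall p1 p2 o, evolution E p10 p20 p1 p2 o -> P E p1 p2 o).

(** * The zones *)

Definition zone_1_1 (E : economy) (p10 p20 : R) : Prop :=
  below_l1 E p10 p20 (Y1 E) (Y2 E) /\ below_l2 E p10 p20 (Y1 E) (Y2 E).
Definition zone_1_2 (E : economy) (p10 p20 : R) : Prop :=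
  Y1 E / p10 + Y2 E / (p10 + rho E) >= q1 E /\ below_l2 E p10 p20 (Y1 E) (Y2 E).
Definition zone_1_3 (E : economy) (p10 p20 : R) : Prop :=
  below_l1 E p10 p20 (Y1 E) (Y2 E) /\ Y1 E / (p20 + rho E) + Y2 E / p20 >= q2 E.
Definition zone_1_4 (E : economy) (p10 p20 : R) : Prop :=
  Y1 E / p10 + Y2 E / (p10 + rho E) >= q1 E /\
  Y1 E / (p20 + rho E) + Y2 E / p20 >= q2 E.

(* Main.v *)
Require Import Defs.
From Stdlib Require Import Reals Lra Lia FunctionalExtensionality.
Open Scope R_scope.

(** Why the statement holds.  A consumer's problem is a two-good fractional
    knapsack, so the greedy plan (fill the cheaper region up to its capacity,
    then spend what is left in the other region) is the selected best reply
    ([best_reply_home_first], [best_reply_foreign_first]).  As [rho > 0], at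
    most one consumer finds the other region cheaper.  The home order of the
    other one then does not depend on what his opponent does
    ([home_order_independent]), which fixes the reply of the opponent and, in
    turn, his own foreign order: the NE exists at most once at any prices
    ([is_NE_unique]).  Hence prices and NE follow a deterministic path, and each
    pattern is proved by exhibiting one evolution ([holds_from_exhibited]).

    In every NE that occurs, one consumer, say I, buys only at home and spends
    his whole income there, so [is_NE_I_at_home] gives all of them.

    If neither region is cheaper abroad, both consumers spend everything at
    home, and the prices drop at once to the type E values.  If
    [p1 + rho < p2], consumer II shops first in region I.  When he can afford
    all that consumer I leaves there, market I clears, the rest of his income
    determines the new [p2], and the result is an equilibrium on the fourth
    line ([holds_from_imports]).  When he cannot, he orders nothing at home,
    [p2] falls to 0 and the first price obeys
    [p := (Y1 + p * Y2 / (p + rho)) / q1].  This map contracts the distance to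
    its positive fixed point [p1_infinity] by a factor bounded away from 1
    ([next_price_gap], [contraction_lt_1]), which gives the infinite downward
    process ([holds_from_collapse]).

    The remaining case [p2 + rho < p1] is the previous one with the regions
    exchanged ([holds_from_swap]); the exchanged fourth line is the third. *)

(** * The knapsack problem of one consumer *)

(** The plan [(x, y)] fills the good of price [a] and capacity [A] before it
    touches the good of price [b] and capacity [B].  The division-free form
    makes sense for [a = 0] too. *)
Definition greedy (a b A B Y x y : R) : Prop :=
  0 <= x <= A /\ 0 <= y <= B /\ a * x + b * y <= Y /\
  (x = A \/ y = 0) /\ ((x = A /\ y = B) \/ a * x + b * y = Y).

(** A unit of payoff costs at least [a], and beyond [A] units it costs [b]. *)
Lemma greedy_optimal a b A B Y x y u v :
  0 <= a <= b -> 0 < b -> 0 < Y -> greedy a b A B Y x y ->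
  0 <= u -> 0 <= v -> a * u + b * v <= Y ->
  Rmin u A + Rmin v B <= x + y.
Proof.
  intros Hab Hb HY (Hx & Hy & Hc & Hg & Hs) Hu Hv Hf.
  pose proof (Rmin_l u A). pose proof (Rmin_r u A).
  pose proof (Rmin_l v B). pose proof (Rmin_r v B).
  destruct Hs as [[-> ->]|Hs]; [lra|].
  assert (Hm : a * Rmin u A + b * Rmin v B <= Y) by nra.
  assert (0 <= Rmin v B) by (apply Rmin_glb; lra).
  destruct Hg as [->| ->]; [nra|].
  destruct (Req_dec a 0) as [->|Ha]; nra.
Qed.

(** Replacing part of [x] by the dearer good cannot lower the expenditure, and a
    greedy plan without the dearer good gets its payoff at unit cost [a]. *)
Lemma greedy_cheapest a b A B Y x y u v :
  0 <= a <= b -> 0 < b -> 0 < Y -> greedy a b A B Y x y ->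
  0 <= u -> 0 <= v -> x + y <= Rmin u A + Rmin v B ->
  a * x + b * y <= a * u + b * v.
Proof.
  intros Hab Hb HY (Hx & Hy & Hc & Hg & Hs) Hu Hv Hp.
  pose proof (Rmin_l u A). pose proof (Rmin_r u A).
  pose proof (Rmin_l v B). pose proof (Rmin_r v B).
  destruct Hg as [->| ->]; nra.
Qed.

Lemma payoff_greedy a b A B Y x y :
  greedy a b A B Y x y -> Rmin x A + Rmin y B = x + y.
Proof.
  intros ([_ Hx] & [_ Hy] & _). now rewrite !Rmin_left.
Qed.

(** * Selected best replies *)

Lemma cheapest_home_first ph pf qh qf Y d h f :
  0 <= ph <= pf -> 0 < pf -> 0 < Y ->
  greedy ph pf qh (Rmax 0 (qf - d)) Y h f ->
  cheapest_maximizer ph pf qh qf Y d h f.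
Proof.
  intros Hp Hpf HY G. pose proof (payoff_greedy _ _ _ _ _ _ _ G) as HG.
  assert (Hfe : feasible ph pf Y h f) by (destruct G as (? & ? & ? & _); red; lra).
  unfold cheapest_maximizer, maximizer, payoff. repeat split; try apply Hfe.
  - intros u v (Hu & Hv & Hc). rewrite HG. now apply (greedy_optimal ph pf _ _ Y).
  - intros u v [(Hu & Hv & _) Hm]. specialize (Hm _ _ Hfe). rewrite HG in Hm.
    now apply (greedy_cheapest ph pf qh (Rmax 0 (qf - d)) Y).
Qed.

Lemma cheapest_foreign_first ph pf qh qf Y d h f :
  0 < pf <= ph -> 0 < Y ->
  greedy pf ph (Rmax 0 (qf - d)) qh Y f h ->
  cheapest_maximizer ph pf qh qf Y d h f.
Proof.
  intros Hp HY G. pose proof (payoff_greedy _ _ _ _ _ _ _ G) as HG.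
  rewrite Rplus_comm, (Rplus_comm f h) in HG.
  assert (Hfe : feasible ph pf Y h f) by (destruct G as (? & ? & ? & _); red; lra).
  unfold cheapest_maximizer, maximizer, payoff. repeat split; try apply Hfe.
  - intros u v (Hu & Hv & Hc). rewrite HG, Rplus_comm, (Rplus_comm h f).
    apply (greedy_optimal pf ph _ _ Y); lra || assumption.
  - intros u v [(Hu & Hv & _) Hm]. specialize (Hm _ _ Hfe). rewrite HG in Hm.
    assert (pf * f + ph * h <= pf * v + ph * u); [|lra].
    apply (greedy_cheapest pf ph (Rmax 0 (qf - d)) qh Y); lra || assumption.
Qed.

(** At equal prices all cheapest maximizers cost the same, and SR2 selects the
    one that fills the home region first. *)
Lemma best_reply_home_first ph pf qh qf Y d h f :
  0 <= ph <= pf -> 0 < pf -> 0 < Y ->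
  greedy ph pf qh (Rmax 0 (qf - d)) Y h f ->
  best_reply ph pf qh qf Y d h f.
Proof.
  intros Hp Hpf HY G.
  pose proof (cheapest_home_first _ _ _ _ _ _ _ _ Hp Hpf HY G) as C.
  destruct (Req_dec ph 0) as [H0|H0].
  - right. split; [easy|]. split; [|now exists h].
    destruct G as (_ & _ & _ & Hg & Hs). rewrite H0 in Hs. nra.
  - left. repeat split; [easy|apply C..|].
    intros u v [[(Hu & Hv & Hc) Hm] Hch].
    specialize (Hch _ _ (proj1 C)).
    specialize (Hm _ _ (proj1 (proj1 C))). unfold payoff in Hm.
    rewrite (payoff_greedy _ _ _ _ _ _ _ G) in Hm.
    pose proof (Rmin_l u qh). pose proof (Rmin_r u qh).
    pose proof (Rmin_l v (Rmax 0 (qf - d))). pose proof (Rmin_r v (Rmax 0 (qf - d))).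
    destruct G as (Hx & Hy & Hb & Hg & Hs).
    destruct Hg as [->| ->].
    + assert (ph * u <= ph * qh) by nra. nra.
    + nra.
Qed.

Lemma best_reply_foreign_first ph pf qh qf Y d h f :
  0 < pf < ph -> 0 < Y ->
  greedy pf ph (Rmax 0 (qf - d)) qh Y f h ->
  best_reply ph pf qh qf Y d h f.
Proof.
  intros Hp HY G.
  assert (Hp' : 0 < pf <= ph) by lra.
  pose proof (cheapest_foreign_first _ _ _ _ _ _ _ _ Hp' HY G) as C.
  left. repeat split; [lra|apply C..|].
  intros u v [[(Hu & Hv & Hc) Hm] Hch].
  specialize (Hch _ _ (proj1 C)).
  specialize (Hm _ _ (proj1 (proj1 C))). unfold payoff in Hm.
  rewrite Rplus_comm, (payoff_greedy _ _ _ _ _ _ _ G) in Hm.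
  pose proof (Rmin_l u qh). pose proof (Rmin_l v (Rmax 0 (qf - d))).
  nra.
Qed.

(** Two cheapest maximizers cost the same and SR2 or SR3 fixes the home order,
    so the foreign orders agree, as the foreign price is positive. *)
Lemma best_reply_unique ph pf qh qf Y d h f h' f' :
  0 < pf ->
  best_reply ph pf qh qf Y d h f -> best_reply ph pf qh qf Y d h' f' ->
  h = h' /\ f = f'.
Proof.
  intros Hpf
    [(H0 & [M C] & S)|(H0 & -> & h0 & [M C])]
    [(H0' & [M' C'] & S')|(H0' & -> & h0' & [M' C'])]; try contradiction.
  - pose proof (C _ _ M'). pose proof (C' _ _ M).
    specialize (S _ _ (conj M' C')). specialize (S' _ _ (conj M C)).
    assert (h = h') by lra. subst. split; [easy|nra].
  - subst ph. pose proof (C _ _ M'). pose proof (C' _ _ M). split; [easy|nra].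
Qed.

(** The order of quantifiers matters: [x] does not depend on [B]. *)
Lemma greedy_exists a b A Y :
  0 <= a -> 0 < b -> 0 < A -> 0 < Y ->
  exists x, forall B, 0 <= B -> exists y, greedy a b A B Y x y.
Proof.
  intros Ha Hb HA HY. destruct (Rle_dec Y (a * A)) as [H|H].
  - assert (0 < a) by nra.
    exists (Y / a). intros B HB. exists 0.
    assert (E : a * (Y / a) = Y) by (field; lra).
    unfold greedy. assert (0 <= Y / a <= A) by (split; nra).
    repeat split; try lra; right; lra.
  - exists A. intros B HB.
    assert (E : b * ((Y - a * A) / b) = Y - a * A) by (field; lra).
    assert (0 <= (Y - a * A) / b) by nra.
    destruct (Rle_dec B ((Y - a * A) / b)) as [HB'|HB'].
    + exists B. unfold greedy. repeat split; try lra; [nra|left; lra..].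
    + exists ((Y - a * A) / b). unfold greedy.
      repeat split; lra.
Qed.

(** A consumer who finds his own region cheaper is served there first, and the
    other consumer's order [d] only limits what he can get abroad. *)
Lemma home_order_independent ph pf qh qf Y d d' h f h' f' :
  0 <= ph <= pf -> 0 < pf -> 0 < qh -> 0 < Y ->
  best_reply ph pf qh qf Y d h f -> best_reply ph pf qh qf Y d' h' f' ->
  h = h'.
Proof.
  intros Hp Hpf Hq HY B B'.
  destruct (greedy_exists ph pf qh Y) as [x Hx]; try easy.
  destruct (Hx (Rmax 0 (qf - d)) (Rmax_l _ _)) as [y Hy].
  destruct (Hx (Rmax 0 (qf - d')) (Rmax_l _ _)) as [y' Hy'].
  apply best_reply_home_first in Hy; try easy.
  apply best_reply_home_first in Hy'; try easy.
  destruct (best_reply_unique _ _ _ _ _ _ _ _ _ _ Hpf B Hy) as [-> _].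
  now destruct (best_reply_unique _ _ _ _ _ _ _ _ _ _ Hpf B' Hy') as [-> _].
Qed.

(** * Exchanging the two regions *)

Definition swap_economy (E : economy) : economy :=
  Economy (q2 E) (q1 E) (Y2 E) (Y1 E) (rho E).

Definition swap_orders (o : orders) : orders :=
  Orders (delta o) (gamma o) (beta o) (alpha o).

Lemma swap_economy_involutive E : swap_economy (swap_economy E) = E.
Proof. now destruct E. Qed.

Lemma swap_orders_involutive o : swap_orders (swap_orders o) = o.
Proof. now destruct o. Qed.

Lemma is_NE_swap E p1 p2 o :
  is_NE E p1 p2 o -> is_NE (swap_economy E) p2 p1 (swap_orders o).
Proof. intros [H1 H2]. now split. Qed.

Lemma is_pe_swap E p1 p2 : is_pe (swap_economy E) p2 p1 -> is_pe E p1 p2.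
Proof.
  intros (H2 & H1 & o & HN & Hd & Ha & HY2 & HY1). cbn in *.
  repeat split; try easy. exists (swap_orders o). cbn.
  apply is_NE_swap in HN. rewrite swap_economy_involutive in HN.
  repeat split; try apply HN; lra.
Qed.

Lemma evolution_swap E p10 p20 p1 p2 o :
  evolution E p10 p20 p1 p2 o ->
  evolution (swap_economy E) p20 p10 p2 p1 (fun t => swap_orders (o t)).
Proof.
  intros (H1 & H2 & H). split; [easy|]. split; [easy|]. intros t.
  destruct (H t) as (HN & S1 & S2).
  split; [now apply is_NE_swap|].
  unfold q1_cons, q2_cons in *. cbn.
  rewrite (Rplus_comm (gamma _)), (Rplus_comm (delta _)). now split.
Qed.

Definition swap_pattern (P : pattern) : pattern := fun E p1 p2 o =>
  P (swap_economy E) p2 p1 (fun t => swap_orders (o t)).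

Lemma holds_from_swap E p10 p20 P :
  holds_from (swap_economy E) p20 p10 P ->
  holds_from E p10 p20 (swap_pattern P).
Proof.
  intros [(p2 & p1 & o & Hex) Hall]. split.
  - exists p1, p2, (fun t => swap_orders (o t)).
    apply evolution_swap in Hex. now rewrite swap_economy_involutive in Hex.
  - intros p1' p2' o' He. apply Hall. now apply evolution_swap.
Qed.

Lemma holds_from_weaken E p10 p20 (P Q : pattern) :
  (forall p1 p2 o, evolution E p10 p20 p1 p2 o -> P E p1 p2 o -> Q E p1 p2 o) ->
  holds_from E p10 p20 P -> holds_from E p10 p20 Q.
Proof. intros PQ [Hex Hall]. split; auto. Qed.

(** * Uniqueness of the Nash equilibrium and of the evolution *)

Definition positive_economy (E : economy) : Prop :=
  0 < q1 E /\ 0 < q2 E /\ 0 < Y1 E /\ 0 < Y2 E /\ 0 < rho E.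

Lemma positive_economy_swap E :
  positive_economy E -> positive_economy (swap_economy E).
Proof. intros (H1 & H2 & H3 & H4 & H5). now repeat split. Qed.

(** The home order of consumer I is fixed, hence the reply of consumer II, hence
    the foreign order of consumer I. *)
Lemma is_NE_unique_home_first E p1 p2 o o' :
  positive_economy E -> 0 <= p1 -> 0 <= p2 -> p1 <= p2 + rho E ->
  is_NE E p1 p2 o -> is_NE E p1 p2 o' -> o = o'.
Proof.
  intros (Hq1 & Hq2 & HY1 & HY2 & Hr) Hp1 Hp2 Hp [B1 B2] [B1' B2'].
  assert (Hp1' : 0 < p1 + rho E) by lra.
  assert (Hp2' : 0 < p2 + rho E) by lra.
  assert (Ha : alpha o = alpha o').
  { refine (home_order_independent _ _ _ _ _ _ _ _ _ _ _ _ _ _ _ B1 B1'); lra. }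
  rewrite Ha in B2.
  destruct (best_reply_unique _ _ _ _ _ _ _ _ _ _ Hp1' B2 B2') as [Hd Hg].
  rewrite Hd in B1.
  destruct (best_reply_unique _ _ _ _ _ _ _ _ _ _ Hp2' B1 B1') as [_ Hb].
  destruct o, o'; cbn in *. congruence.
Qed.

Lemma is_NE_unique E p1 p2 o o' :
  positive_economy E -> 0 <= p1 -> 0 <= p2 ->
  is_NE E p1 p2 o -> is_NE E p1 p2 o' -> o = o'.
Proof.
  intros HE Hp1 Hp2 HN HN'.
  destruct (Rle_dec p1 (p2 + rho E)) as [Hp|Hp].
  - now apply (is_NE_unique_home_first E p1 p2).
  - rewrite <- (swap_orders_involutive o), <- (swap_orders_involutive o').
    f_equal.
    apply (is_NE_unique_home_first (swap_economy E) p2 p1);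
      try apply is_NE_swap; try easy.
    + now apply positive_economy_swap.
    + destruct HE as (_ & _ & _ & _ & Hr). cbn. lra.
Qed.

Lemma price_step_unique q qcons Yres p pn pn' :
  price_step q qcons Yres p pn -> price_step q qcons Yres p pn' -> pn = pn'.
Proof.
  intros (D & U & S) (D' & U' & S').
  destruct (Rlt_dec qcons q) as [H|H]; [rewrite D, D'; easy|].
  destruct (Rlt_dec (p * q) Yres) as [H'|H']; [rewrite U, U'; easy|].
  rewrite S, S'; easy.
Qed.

Lemma evolution_unique E p10 p20 p1 p2 o p1' p2' o' :
  positive_economy E -> (forall t, 0 <= p1 t /\ 0 <= p2 t) ->
  evolution E p10 p20 p1 p2 o -> evolution E p10 p20 p1' p2' o' ->
  forall t, p1 t = p1' t /\ p2 t = p2' t /\ o t = o' t.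
Proof.
  intros HE Hpos (H1 & H2 & H) (H1' & H2' & H').
  assert (HO : forall t, p1 t = p1' t -> p2 t = p2' t -> o t = o' t).
  { intros t E1 E2. destruct (H t) as [HN _]. destruct (H' t) as [HN' _].
    rewrite <- E1, <- E2 in HN'. destruct (Hpos t).
    now apply (is_NE_unique E (p1 t) (p2 t)). }
  assert (HP : forall t, p1 t = p1' t /\ p2 t = p2' t).
  { induction t as [|t [E1 E2]]; [split; congruence|].
    pose proof (HO t E1 E2) as Eo.
    destruct (H t) as (_ & S1 & S2). destruct (H' t) as (_ & S1' & S2').
    rewrite <- E1, <- E2, <- Eo in S1', S2'.
    split; eapply price_step_unique; eassumption. }
  intros t. destruct (HP t). repeat split; auto.
Qed.

Lemma holds_from_exhibited E p10 p20 (P : pattern) p1 p2 o :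
  positive_economy E -> (forall t, 0 <= p1 t /\ 0 <= p2 t) ->
  evolution E p10 p20 p1 p2 o -> P E p1 p2 o -> holds_from E p10 p20 P.
Proof.
  intros HE Hpos He HP. split; [now exists p1, p2, o|].
  intros p1' p2' o' He'.
  pose proof (evolution_unique _ _ _ _ _ _ _ _ _ HE Hpos He He') as Heq.
  replace p1' with p1 by (apply functional_extensionality; apply Heq).
  replace p2' with p2 by (apply functional_extensionality; apply Heq).
  now replace o' with o by (apply functional_extensionality; apply Heq).
Qed.

(** * Equilibria in which consumer I buys only at home *)

(** The last two hypotheses are the greedy conditions of consumer II; the
    capacity that consumer I leaves him in region I is [q1 E - Y1 E / p1]. *)
Lemma is_NE_I_at_home E p1 p2 g D :
  positive_economy E -> 0 < p1 -> 0 <= p2 -> Y1 E <= p1 * q1 E ->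
  0 <= g <= q1 E - Y1 E / p1 -> 0 <= D <= q2 E ->
  (p1 + rho E) * g + p2 * D = Y2 E ->
  (p1 <= p2 + rho E \/ D = q2 E) ->
  (p2 <= p1 + rho E -> D = q2 E \/ g = 0) ->
  (p1 + rho E < p2 -> g = q1 E - Y1 E / p1 \/ D = 0) ->
  is_NE E p1 p2 (Orders (Y1 E / p1) 0 g D).
Proof.
  intros (Hq1 & Hq2 & HY1 & HY2 & Hr) Hp1 Hp2 HY Hg HD Hspend HI HIIh HIIf.
  assert (Ha : p1 * (Y1 E / p1) = Y1 E) by (field; lra).
  assert (0 <= Y1 E / p1) by nra.
  split; cbn.
  - destruct (Rle_dec p1 (p2 + rho E)) as [Hp|Hp].
    + apply best_reply_home_first; try lra.
      pose proof (Rmax_l 0 (q2 E - D)).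
      unfold greedy. repeat split; lra.
    + apply best_reply_foreign_first; try lra.
      rewrite Rmax_left by lra.
      unfold greedy. repeat split; lra.
  - destruct (Rle_dec p2 (p1 + rho E)) as [Hp|Hp].
    + apply best_reply_home_first; try lra.
      rewrite Rmax_right by lra. specialize (HIIh Hp).
      unfold greedy. repeat split; lra.
    + apply best_reply_foreign_first; try lra.
      rewrite Rmax_right by lra. specialize (HIIf ltac:(lra)).
      unfold greedy. repeat split; lra.
Qed.

(** * Price steps *)

Lemma price_step_down q qcons Yres p :
  qcons < q -> Yres <= p * q -> price_step q qcons Yres p (p * qcons / q).
Proof. intros H H'. repeat split; intros; lra. Qed.

Lemma price_step_stay q qcons Yres p :
  qcons = q -> Yres <= p * q -> price_step q qcons Yres p p.
Proof. intros -> H'. repeat split; intros; lra. Qed.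

Lemma best_reply_feasible ph pf qh qf Y d h f :
  0 < qh -> best_reply ph pf qh qf Y d h f -> 0 <= h /\ 0 <= f.
Proof.
  intros Hq [(_ & [[(H1 & H2 & _) _] _] & _)|(_ & -> & h0 & [[(_ & H2 & _) _] _])];
    lra.
Qed.

(** What [is_pe] requires of its witness [o]. *)
Definition clears (E : economy) (p1 p2 : R) (o : orders) : Prop :=
  is_NE E p1 p2 o /\
  alpha o + gamma o = q1 E /\
  beta o + delta o = q2 E /\
  p1 * alpha o + (p2 + rho E) * beta o = Y1 E /\
  (p1 + rho E) * gamma o + p2 * delta o = Y2 E.

(** The income left for the home region is what was spent there, which is at
    most the value of the supply. *)
Lemma clears_stationary E p1 p2 o :
  positive_economy E -> 0 <= p1 -> 0 <= p2 -> clears E p1 p2 o ->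
  price_step (q1 E) (q1_cons o) (Y1_res E p2 o) p1 p1 /\
  price_step (q2 E) (q2_cons o) (Y2_res E p1 o) p2 p2.
Proof.
  intros (Hq1 & Hq2 & _) Hp1 Hp2 ([B1 B2] & H1 & H2 & HY1 & HY2).
  apply best_reply_feasible in B1, B2; try easy.
  split; apply price_step_stay; unfold q1_cons, q2_cons, Y1_res, Y2_res; nra.
Qed.

Definition first_then {A : Type} (x y : A) (t : nat) : A :=
  match t with O => x | S _ => y end.

Lemma evolution_one_step E p10 p20 p11 p21 o0 o1 :
  positive_economy E -> 0 <= p11 -> 0 <= p21 ->
  is_NE E p10 p20 o0 ->
  price_step (q1 E) (q1_cons o0) (Y1_res E p20 o0) p10 p11 ->
  price_step (q2 E) (q2_cons o0) (Y2_res E p10 o0) p20 p21 ->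
  clears E p11 p21 o1 ->
  evolution E p10 p20 (first_then p10 p11) (first_then p20 p21) (first_then o0 o1).
Proof.
  intros HE H1 H2 HN S1 S2 HC.
  destruct (clears_stationary _ _ _ _ HE H1 H2 HC) as [S1' S2'].
  split; [easy|]. split; [easy|].
  intros [|t]; cbn; [easy|]. split; [apply HC|easy].
Qed.

Lemma reached_first_then (Eq : R -> R -> Prop) p10 p11 p20 p21 :
  Eq p11 p21 -> reached_after_one_step Eq (first_then p10 p11) (first_then p20 p21).
Proof. intros H. split; [easy|]. intros [|t] Ht; [lia|easy]. Qed.

(** * Adjustments that end after one step *)

(** The condition on [p2] says that market II is worth what consumer II has left
    after clearing market I.  Whichever region is cheaper, nothing is left in
    region II for consumer I. *)
Lemma clears_I_at_home E p1 p2 :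
  positive_economy E -> 0 < p1 -> 0 <= p2 -> Y1 E <= p1 * q1 E ->
  p2 * q2 E = Y2 E - (p1 + rho E) * (q1 E - Y1 E / p1) ->
  clears E p1 p2 (Orders (Y1 E / p1) 0 (q1 E - Y1 E / p1) (q2 E)).
Proof.
  intros HE Hp1 Hp2 HY HY2.
  assert (Ha : p1 * (Y1 E / p1) = Y1 E) by (field; lra).
  assert (0 <= q1 E - Y1 E / p1) by nra.
  split; [|cbn; repeat split; lra].
  destruct HE as (Hq1 & Hq2 & HE).
  apply is_NE_I_at_home; easy || lra.
Qed.

(** The type E prices need not leave both consumers preferring their own region.
    One who prefers the other region still finds it sold out there. *)
Lemma holds_from_autarky E p10 p20 :
  positive_economy E -> 0 < p10 -> 0 < p20 ->
  Y1 E < p10 * q1 E -> Y2 E < p20 * q2 E ->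
  - rho E <= p10 - p20 <= rho E ->
  holds_from E p10 p20 P1.
Proof.
  intros HE Hp1 Hp2 HY1 HY2 Hp.
  pose proof HE as (Hq1 & Hq2 & HY1' & HY2' & Hr).
  pose (a := Y1 E / p10). pose (D := Y2 E / p20).
  assert (Ha : p10 * a = Y1 E) by (unfold a; field; lra).
  assert (HD : p20 * D = Y2 E) by (unfold D; field; lra).
  assert (0 <= a < q1 E) by nra. assert (0 <= D < q2 E) by nra.
  assert (HN : is_NE E p10 p20 (Orders a 0 0 D)).
  { apply is_NE_I_at_home; fold a; easy || lra. }
  pose (p11 := Y1 E / q1 E). pose (p21 := Y2 E / q2 E).
  assert (Hp11 : p11 * q1 E = Y1 E) by (unfold p11; field; lra).
  assert (Hp21 : p21 * q2 E = Y2 E) by (unfold p21; field; lra).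
  assert (0 < p11) by nra. assert (0 < p21) by nra.
  assert (Hfull : Y1 E / p11 = q1 E) by (unfold p11; field; lra).
  assert (HC : clears E p11 p21 (Orders (Y1 E / p11) 0 (q1 E - Y1 E / p11) (q2 E))).
  { apply clears_I_at_home; trivial; rewrite ?Hfull; lra. }
  assert (D1 : downward_adjustment (q1 E) (q1_cons (Orders a 0 0 D)) p10 p11).
  { unfold q1_cons; cbn. split; [lra|]. unfold p11. rewrite <- Ha. field. lra. }
  assert (D2 : downward_adjustment (q2 E) (q2_cons (Orders a 0 0 D)) p20 p21).
  { unfold q2_cons; cbn. split; [lra|]. unfold p21. rewrite <- HD. field. lra. }
  apply (holds_from_exhibited E p10 p20 P1 (first_then p10 p11) (first_then p20 p21)
           (first_then (Orders a 0 0 D)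
              (Orders (Y1 E / p11) 0 (q1 E - Y1 E / p11) (q2 E)))).
  - exact HE.
  - intros [|t]; cbn; lra.
  - apply (evolution_one_step E p10 p20 p11 p21); try exact HN; try exact HC;
      trivial; try lra.
    + destruct D1 as [D1 ->]. apply price_step_down; [easy|].
      unfold Y1_res; cbn. lra.
    + destruct D2 as [D2 ->]. apply price_step_down; [easy|].
      unfold Y2_res; cbn. lra.
  - split; [easy|]. split; [exact D1|]. split; [exact D2|].
    apply reached_first_then. split; [|easy].
    repeat split; try lra. eexists. exact HC.
Qed.

(** Consumer II buys all that consumer I leaves in region I, and what remains of
    his income becomes the value of market II.  On the first line nothing
    remains, and the second price drops to 0. *)
Definition imports_pattern : pattern := fun E p1 p2 o =>
  o 0%nat = Orders
    (Y1 E / p1 0%nat)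
    0
    (q1 E - Y1 E / p1 0%nat)
    ((Y2 E - (p1 0%nat + rho E) * (q1 E - Y1 E / p1 0%nat)) / p2 0%nat) /\
  downward2 E p2 o 0 /\ p1 1%nat = p1 0%nat /\
  reached_after_one_step (l4_equilibrium E) p1 p2.

Lemma holds_from_imports E p10 p20 :
  positive_economy E -> 0 < p10 -> 0 < p20 ->
  Y1 E < p10 * q1 E -> Y2 E < p20 * q2 E ->
  p10 - p20 < - rho E ->
  Y1 E / p10 + Y2 E / (p10 + rho E) >= q1 E ->
  holds_from E p10 p20 imports_pattern.
Proof.
  intros HE Hp1 Hp2 HY1 HY2 Hp Habove.
  pose proof HE as (Hq1 & Hq2 & HY1' & HY2' & Hr).
  pose (a := Y1 E / p10). pose (rest := Y2 E - (p10 + rho E) * (q1 E - a)).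
  pose (D := rest / p20).
  assert (Ha : p10 * a = Y1 E) by (unfold a; field; lra).
  assert (HD : p20 * D = rest) by (unfold D; field; lra).
  assert (0 <= a < q1 E) by nra.
  assert (0 <= rest).
  { fold a in Habove.
    assert ((p10 + rho E) * (Y2 E / (p10 + rho E)) = Y2 E) by (field; lra).
    unfold rest. nra. }
  assert (rest <= Y2 E) by (unfold rest; nra).
  assert (0 <= D < q2 E) by nra.
  pose (o0 := Orders a 0 (q1 E - a) D).
  assert (HN : is_NE E p10 p20 o0).
  { apply is_NE_I_at_home; fold a; trivial; try lra; [unfold rest in HD; lra]. }
  pose (p21 := rest / q2 E).
  assert (Hp21 : p21 * q2 E = rest) by (unfold p21; field; lra).
  assert (0 <= p21) by nra.
  assert (HC : clears E p10 p21 (Orders (Y1 E / p10) 0 (q1 E - Y1 E / p10) (q2 E))).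
  { apply clears_I_at_home; trivial; lra. }
  assert (D2 : downward_adjustment (q2 E) (q2_cons o0) p20 p21).
  { unfold q2_cons; cbn. split; [lra|]. unfold p21. rewrite <- HD. field. lra. }
  apply (holds_from_exhibited E p10 p20 imports_pattern
           (first_then p10 p10) (first_then p20 p21)
           (first_then o0 (Orders (Y1 E / p10) 0 (q1 E - Y1 E / p10) (q2 E)))).
  - exact HE.
  - intros [|t]; cbn; lra.
  - apply (evolution_one_step E p10 p20 p10 p21); try exact HN; try exact HC;
      trivial; try lra.
    + apply price_step_stay; unfold q1_cons, Y1_res; cbn; lra.
    + destruct D2 as [D2 ->]. apply price_step_down; [easy|].
      unfold Y2_res; cbn. fold rest. lra.
  - split; [easy|]. split; [exact D2|]. split; [easy|].
    apply reached_first_then. split; [|split; [easy|split; [lra|]]].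
    + repeat split; try lra. eexists. exact HC.
    + unfold on_l4. rewrite Hp21. unfold rest, a. field. lra.
Qed.

Lemma P2_of_imports E p10 p20 :
  0 < p10 -> 0 < p20 -> 0 < rho E ->
  holds_from E p10 p20 imports_pattern -> holds_from E p10 p20 P2.
Proof.
  intros Hp1 Hp2 Hr. apply holds_from_weaken.
  intros p1 p2 o (E1 & E2 & _) (Ho & Hd & H1 & Heq & Hst).
  split; [easy|]. split; [easy|]. intros Hl.
  assert (H2 : p2 1%nat = 0).
  { destruct Hd as [_ ->]. unfold q2_cons. rewrite Ho. cbn.
    unfold on_l1 in Hl. rewrite Hl, E1, E2.
    unfold Rdiv at 1. apply Rmult_eq_0_compat_r.
    field. lra. }
  split; [|intros t Ht; now rewrite (proj2 (Hst t Ht))].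
  split; [|easy]. split; [apply Heq|].
  rewrite H1, H2, E1 in *. now repeat split.
Qed.

(** Exchanging the regions turns the fourth line into the third. *)
Lemma P3_of_imports E p10 p20 :
  0 < p20 ->
  holds_from (swap_economy E) p20 p10 imports_pattern -> holds_from E p10 p20 P3.
Proof.
  intros Hp2 H. apply holds_from_swap in H. revert H. apply holds_from_weaken.
  intros p1 p2 o (E1 & E2 & _) (Ho & [Hd Hd'] & H1 & (Hpe & Hlt & Hle & Hl) & Hst).
  cbn in *.
  apply is_pe_swap in Hpe.
  split; [|split; [|split; [easy|split]]].
  - rewrite <- (swap_orders_involutive (o 0%nat)), Ho. reflexivity.
  - unfold downward1, downward_adjustment, q1_cons, q2_cons in *. cbn in *.
    now rewrite (Rplus_comm (alpha _)).
  - split; [easy|]. split; [apply Hpe|]. split; [now rewrite H1, E2|].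
    repeat split; try easy. unfold on_l3, on_l4 in *. cbn in *. lra.
  - intros t Ht. now destruct (Hst t Ht).
Qed.

(** * Collapse of the second price *)

(** The positive zero of a quadratic whose zeros have product
    [- rho E * Y1 E / q1 E]. *)
Lemma p1_infinity_spec E :
  positive_economy E ->
  0 < p1_infinity E /\
  q1 E * p1_infinity E * (p1_infinity E + rho E) =
    Y1 E * (p1_infinity E + rho E) + Y2 E * p1_infinity E.
Proof.
  intros (Hq1 & Hq2 & HY1 & HY2 & Hr). unfold p1_infinity.
  set (S := Y1 E + Y2 E - rho E * q1 E).
  assert (Hk : 0 < rho E * q1 E * Y1 E) by (repeat apply Rmult_lt_0_compat; easy).
  set (r := sqrt (S ^ 2 + 4 * rho E * q1 E * Y1 E)).
  assert (Hr2 : r * r = S ^ 2 + 4 * rho E * q1 E * Y1 E) by (apply sqrt_sqrt; nra).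
  assert (Hr0 : 0 <= r) by apply sqrt_pos.
  assert (HS : 0 < S + r) by nra.
  assert (Hi : 0 < 1 / (2 * q1 E)) by (apply Rdiv_lt_0_compat; lra).
  split; [nra|].
  set (l := 1 / (2 * q1 E) * (S + r)).
  (* Squaring this gives the quadratic equation, times [4 * q1 E]. *)
  assert (Hl : 2 * q1 E * l - S = r) by (unfold l; field; lra).
  rewrite <- Hl in Hr2. unfold S in Hr2. nra.
Qed.

Definition next_price (E : economy) (p : R) : R :=
  p * (Y1 E / p + Y2 E / (p + rho E)) / q1 E.

(** Comparing [next_price] at [p] and at its fixed point: the distance is
    multiplied by the slope of the chord of [p * Y2 E / (p + rho E)], divided by
    [q1 E]. *)
Lemma next_price_gap E p :
  positive_economy E -> 0 < p ->
  next_price E p - p1_infinity E =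
  Y2 E * rho E / (q1 E * (p + rho E) * (p1_infinity E + rho E)) *
  (p - p1_infinity E).
Proof.
  intros HE Hp. destruct (p1_infinity_spec E HE) as [Hl Hfix].
  destruct HE as (Hq1 & Hq2 & HY1 & HY2 & Hr).
  set (l := p1_infinity E) in *.
  assert (Hl' : l = (Y1 E + l * (Y2 E / (l + rho E))) / q1 E).
  { apply (Rmult_eq_reg_r (q1 E * (l + rho E))); [|nra].
    field_simplify; lra. }
  rewrite Hl' at 1. unfold next_price. field. lra.
Qed.

Definition contraction (E : economy) : R :=
  Y2 E * rho E / (q1 E * (p1_infinity E + rho E) * (p1_infinity E + rho E)).

(** At the fixed point [Y2 E / (p + rho E) < q1 E], because consumer I buys the
    rest of [q1 E]. *)
Lemma contraction_lt_1 E : positive_economy E -> 0 < contraction E < 1.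
Proof.
  intros HE. destruct (p1_infinity_spec E HE) as [Hl Hfix].
  destruct HE as (Hq1 & Hq2 & HY1 & HY2 & Hr).
  unfold contraction. set (l := p1_infinity E) in *.
  assert (HY : Y2 E < q1 E * (l + rho E)) by nra.
  assert (0 < q1 E * (l + rho E) * (l + rho E)) by (repeat apply Rmult_lt_0_compat; lra).
  split.
  - apply Rdiv_lt_0_compat; nra.
  - apply (Rmult_lt_reg_r (q1 E * (l + rho E) * (l + rho E))); [easy|].
    unfold Rdiv. rewrite Rmult_assoc, Rinv_l by lra. nra.
Qed.

Lemma next_price_contracts E p :
  positive_economy E -> p1_infinity E < p ->
  p1_infinity E < next_price E p /\
  next_price E p - p1_infinity E <= contraction E * (p - p1_infinity E).
Proof.
  intros HE Hp. pose proof (p1_infinity_spec E HE) as [Hl _].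
  pose proof (next_price_gap E p HE ltac:(lra)) as Hgap.
  destruct HE as (Hq1 & Hq2 & HY1 & HY2 & Hr).
  set (l := p1_infinity E) in *.
  assert (Hd : 0 < q1 E * (l + rho E) * (l + rho E)) by (repeat apply Rmult_lt_0_compat; lra).
  assert (Hd' : q1 E * (l + rho E) * (l + rho E) <= q1 E * (p + rho E) * (l + rho E)).
  { apply Rmult_le_compat_r; [lra|]. apply Rmult_le_compat_l; lra. }
  assert (Hn : 0 < Y2 E * rho E) by nra.
  assert (Hs : 0 < Y2 E * rho E / (q1 E * (p + rho E) * (l + rho E))).
  { apply Rdiv_lt_0_compat; lra. }
  split; [nra|]. rewrite Hgap. apply Rmult_le_compat_r; [lra|].
  unfold contraction. fold l. apply Rmult_le_compat_l; [lra|].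
  now apply Rinv_le_contravar.
Qed.

(** The right-hand side is the demand for good 1 when both consumers spend
    everything in region I. *)
Lemma above_p1_infinity_iff E p :
  positive_economy E -> 0 < p ->
  (p1_infinity E < p <-> Y1 E / p + Y2 E / (p + rho E) < q1 E).
Proof.
  intros HE Hp. destruct (p1_infinity_spec E HE) as [Hl Hfix].
  destruct HE as (Hq1 & Hq2 & HY1 & HY2 & Hr).
  set (l := p1_infinity E) in *. clearbody l.
  assert (Hpp : 0 < p * (p + rho E)) by nra.
  assert (Hm : (Y1 E / p + Y2 E / (p + rho E)) * (p * (p + rho E)) =
               Y1 E * (p + rho E) + Y2 E * p) by (field; lra).
  (* The quadratic at [p], scaled by [l], factors through its zero [l]. *)
  assert (Hf : l * (q1 E * p * (p + rho E) - (Y1 E * (p + rho E) + Y2 E * p)) =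
               (p - l) * (q1 E * p * l + rho E * Y1 E)) by nra.
  assert (Hc : 0 < q1 E * p * l + rho E * Y1 E).
  { apply Rplus_lt_0_compat; repeat apply Rmult_lt_0_compat; lra. }
  split; intros H.
  - apply (Rmult_lt_reg_r (p * (p + rho E))); [easy|]. rewrite Hm.
    assert (0 < (p - l) * (q1 E * p * l + rho E * Y1 E)) by (apply Rmult_lt_0_compat; lra).
    nra.
  - assert (Y1 E * (p + rho E) + Y2 E * p < q1 E * (p * (p + rho E))).
    { rewrite <- Hm. now apply Rmult_lt_compat_r. }
    assert (0 < (p - l) * (q1 E * p * l + rho E * Y1 E)).
    { rewrite <- Hf. apply Rmult_lt_0_compat; lra. }
    nra.
Qed.

Lemma Un_cv_geometric (u : nat -> R) l k :
  0 <= k < 1 -> (forall t, l <= u t) ->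
  (forall t, u (S t) - l <= k * (u t - l)) -> Un_cv u l.
Proof.
  intros Hk Hl Hu.
  assert (Hb : forall t, u t - l <= k ^ t * (u 0%nat - l)).
  { induction t as [|t IH]; cbn; [lra|]. pose proof (Hu t). nra. }
  intros eps Heps.
  destruct (pow_lt_1_zero k) with (y := eps / (u 0%nat - l + 1)) as [N HN].
  - rewrite Rabs_right; lra.
  - apply Rdiv_lt_0_compat; [easy|]. pose proof (Hl 0%nat). lra.
  - exists N. intros n Hn. specialize (HN n Hn). specialize (Hb n).
    pose proof (Hl n). pose proof (Hl 0%nat).
    assert (0 <= k ^ n) by (apply pow_le; lra).
    rewrite Rabs_right in HN by lra.
    unfold R_dist. rewrite Rabs_right by lra.
    apply (Rmult_lt_compat_r (u 0%nat - l + 1)) in HN; [|lra].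
    unfold Rdiv in HN. rewrite Rmult_assoc, Rinv_l in HN by lra. nra.
Qed.

(** Consumer II cannot afford what consumer I leaves in region I, so he orders
    nothing at home and the second price falls to 0 at once.  From then on he
    orders [q2 E] at home for free, and both incomes keep chasing the goods of
    region I, whose price stays above [p1_infinity]. *)
Lemma holds_from_collapse E p10 p20 :
  positive_economy E -> 0 < p10 -> 0 < p20 ->
  Y1 E < p10 * q1 E -> Y2 E < p20 * q2 E ->
  p10 - p20 < - rho E ->
  below_l1 E p10 p20 (Y1 E) (Y2 E) ->
  holds_from E p10 p20 P4.
Proof.
  intros HE Hp1 Hp2 HY1 HY2 Hp Hbelow.
  pose proof (p1_infinity_spec E HE) as [Hl Hfix].
  pose proof (contraction_lt_1 E HE) as Hk.
  pose proof HE as (Hq1 & Hq2 & HY1' & HY2' & Hr).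
  pose (l := p1_infinity E). fold l in Hl, Hfix.
  pose (p1 := fun t => Nat.iter t (next_price E) p10).
  pose (p2 := first_then p20 0).
  pose (o := fun t => Orders (Y1 E / p1 t) 0 (Y2 E / (p1 t + rho E))
                        (first_then 0 (q2 E) t)).
  assert (Habove : forall t, l < p1 t).
  { induction t as [|t IH].
    - now apply above_p1_infinity_iff.
    - now apply next_price_contracts. }
  assert (Hexcess : forall t, Y1 E / p1 t + Y2 E / (p1 t + rho E) < q1 E).
  { intros t. specialize (Habove t). apply above_p1_infinity_iff; easy || lra. }
  assert (Hnext : forall t, p1 (S t) = p1 t * q1_cons (o t) / q1 E) by reflexivity.
  assert (Hpos : forall t, 0 < p1 t) by (intros t; specialize (Habove t); lra).
  assert (Hg : forall t, 0 <= Y2 E / (p1 t + rho E)).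
  { intros t. specialize (Hpos t). apply Rlt_le, Rdiv_lt_0_compat; lra. }
  assert (Ha : forall t, p1 t * (Y1 E / p1 t) = Y1 E).
  { intros t. specialize (Hpos t). field. lra. }
  assert (HG : forall t, (p1 t + rho E) * (Y2 E / (p1 t + rho E)) = Y2 E).
  { intros t. specialize (Hpos t). field. lra. }
  assert (Hdecr : forall t, p1 (S t) < p1 t).
  { intros t. rewrite Hnext. specialize (Hexcess t). specialize (Hpos t).
    apply (Rmult_lt_reg_r (q1 E)); [easy|]. unfold q1_cons, o; cbn.
    unfold Rdiv at 1. rewrite Rmult_assoc, Rinv_l by lra. nra. }
  assert (HN : forall t, is_NE E (p1 t) (p2 t) (o t)).
  { intros t. specialize (Hpos t). specialize (Hexcess t).
    specialize (Hg t). specialize (Ha t). specialize (HG t).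
    assert (Y1 E <= p1 t * q1 E) by nra.
    apply is_NE_I_at_home; try easy; destruct t as [|t]; cbn [p2 first_then];
      change (p1 0%nat) with p10 in *; lra. }
  assert (He : evolution E p10 p20 p1 p2 o).
  { split; [easy|]. split; [easy|]. intros t. split; [easy|].
    specialize (Hpos t). specialize (Hexcess t).
    specialize (Hg t). specialize (Ha t). specialize (HG t).
    split.
    - rewrite Hnext. apply price_step_down; [easy|].
      unfold Y1_res, o; cbn -[p1]. nra.
    - unfold q2_cons, Y2_res, o; cbn -[p1].
      destruct t as [|t].
      + cbn [p2 first_then] in *. repeat split; intros; lra.
      + apply price_step_stay; cbn -[p1] in *; lra. }
  assert (Hl1 : q1 E = Y1 E / l + Y2 E / (l + rho E)).
  { apply (Rmult_eq_reg_r (l * (l + rho E))); [|nra]. field_simplify; lra. }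
  assert (Hlim : degenerate_l1_equilibrium E l 0).
  { assert (Y1 E / l * l = Y1 E) by (field; lra).
    assert (0 < Y2 E / (l + rho E)) by (apply Rdiv_lt_0_compat; lra).
    split; [|now repeat split].
    split; [lra|]. split; [lra|].
    exists (Orders (Y1 E / l) 0 (q1 E - Y1 E / l) (q2 E)).
    apply clears_I_at_home; try easy; try lra; [nra|].
    replace (q1 E - Y1 E / l) with (Y2 E / (l + rho E)) by lra. field. lra. }
  apply (holds_from_exhibited E p10 p20 P4 p1 p2 o); try easy.
  - intros t. specialize (Hpos t). split; [lra|]. destruct t; cbn; lra.
  - split; [easy|]. split; [|split; [|split; [|exact Hlim]]].
    + intros [|t] Ht; [lia|easy].
    + intros t. split; [|easy]. split; [apply Hexcess|easy].
    + apply (Un_cv_geometric _ _ (contraction E)); [lra|intros t..].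
      * now apply Rlt_le.
      * now apply next_price_contracts.
Qed.

Lemma P5_of_collapse E p10 p20 :
  holds_from (swap_economy E) p20 p10 P4 -> holds_from E p10 p20 P5.
Proof.
  intros H. apply holds_from_swap in H. revert H. apply holds_from_weaken.
  intros p1 p2 o _ (Ho & H0 & Hd & Hcv & Hpe & Hl & _ & Hl1).
  split.
  - rewrite <- (swap_orders_involutive (o 0%nat)), Ho. reflexivity.
  - exists (p1_infinity (swap_economy E)).
    split; [easy|]. split; [|split; [easy|]].
    + intros t. destruct (Hd t) as [D Hlt]. split; [|easy].
      unfold downward1, downward2, q1_cons, q2_cons in *. cbn in *.
      now rewrite (Rplus_comm (beta _)).
    + apply is_pe_swap in Hpe. split; [easy|]. repeat split; try easy.
      unfold on_l1, on_l2 in *. cbn in *. lra.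
Qed.

Theorem proposition4p6 :
  forall (E : economy) (p10 p20 : R),
    0 < q1 E -> 0 < q2 E -> 0 < Y1 E -> 0 < Y2 E -> 0 < rho E ->
    0 < p10 -> 0 < p20 ->
    p20 * q2 E < p10 * q1 E -> p10 * q1 E < (p20 + rho E) * q2 E ->
    Y1 E < p10 * q1 E -> Y2 E < p20 * q2 E ->
    (zone_1_4 E p10 p20 ->
       (- rho E <= p10 - p20 <= rho E -> holds_from E p10 p20 P1) /\
       (p10 - p20 < - rho E -> holds_from E p10 p20 P2) /\
       (p10 - p20 > rho E -> holds_from E p10 p20 P3)) /\
    (zone_1_3 E p10 p20 ->
       (- rho E <= p10 - p20 <= rho E -> holds_from E p10 p20 P1) /\
       (p10 - p20 > rho E -> holds_from E p10 p20 P3) /\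
       (p10 - p20 < - rho E -> holds_from E p10 p20 P4)) /\
    (zone_1_2 E p10 p20 ->
       (- rho E <= p10 - p20 <= rho E -> holds_from E p10 p20 P1) /\
       (p10 - p20 < - rho E -> holds_from E p10 p20 P2) /\
       (p10 - p20 > rho E -> holds_from E p10 p20 P5)) /\
    (zone_1_1 E p10 p20 ->
       (- rho E <= p10 - p20 <= rho E -> holds_from E p10 p20 P1) /\
       (p10 - p20 < - rho E -> holds_from E p10 p20 P4) /\
       (p10 - p20 > rho E -> holds_from E p10 p20 P5)).
Proof.
  intros E p10 p20 Hq1 Hq2 HY1 HY2 Hr Hp1 Hp2 _ _ HY1' HY2'.
  assert (HE : positive_economy E) by now repeat split.
  assert (HE' : positive_economy (swap_economy E)) by now apply positive_economy_swap.
  assert (HP1 : - rho E <= p10 - p20 <= rho E -> holds_from E p10 p20 P1)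
    by now apply holds_from_autarky.
  assert (HP2 : Y1 E / p10 + Y2 E / (p10 + rho E) >= q1 E ->
                p10 - p20 < - rho E -> holds_from E p10 p20 P2).
  { intros. apply P2_of_imports; try easy. now apply holds_from_imports. }
  assert (HP3 : Y1 E / (p20 + rho E) + Y2 E / p20 >= q2 E ->
                p10 - p20 > rho E -> holds_from E p10 p20 P3).
  { intros. apply P3_of_imports; [easy|].
    apply holds_from_imports; try easy; cbn; lra. }
  assert (HP4 : below_l1 E p10 p20 (Y1 E) (Y2 E) ->
                p10 - p20 < - rho E -> holds_from E p10 p20 P4).
  { intros. now apply holds_from_collapse. }
  assert (HP5 : below_l2 E p10 p20 (Y1 E) (Y2 E) ->
                p10 - p20 > rho E -> holds_from E p10 p20 P5).
  { unfold below_l2. intros. apply P5_of_collapse.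
    apply holds_from_collapse; try easy; unfold below_l1; cbn; lra. }
  unfold zone_1_1, zone_1_2, zone_1_3, zone_1_4. tauto.
Qed.
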